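(* Let $N \in \mathbb{N}$, let $K$ be a reduced ring, let $f \in K[X_1, \ldots, X_N]$, and let $a_1, b_1, \ldots, a_N, b_N \in K \setminus \{0\}$ with $a_i \neq b_i$ for all $i \in \{1,\ldots,N\}$. Assume that for each $i \in \{1,\ldots,N\}$ there exists $r_i \in \mathbb{N}$ such that $a_i^{r_i} = b_i^{r_i}$ (fix such $r_i$). Let $Q := \{a_1,b_1\} \times \cdots \times \{a_N, b_N\}$. Suppose that $f$ is absorbing at $(a_1,\ldots,a_N)$ for $Q$, and that \[ b_1 \cdots b_N \cdot f(b_1, \ldots, b_N) \neq 0. \] Then $M(f) \ge \prod_{i=1}^N \frac{r_i}{r_i - 1}$.
   Context: $\mathbb{N}$ denotes the set of positive integers. A reduced ring is a commutative ring with $1$ that has no nonzero nilpotent elements. For a polynomial $f$ in $K[X_1,\ldots,X_N]$, $M(f)$ denotes the number of monomials $X_1^{e_1}\cdots X_N^{e_N}$ that appear in $f$ with nonzero coefficient. For $Q = A_1 \times \cdots \times A_N \subseteq K^N$ and $\mathbf{a} = (a_1,\ldots,a_N) \in Q$, the polynomial $f$ is called absorbing at $\mathbf{a}$ for $Q$ if for all $(x_1,\ldots,x_N) \in Q$: if there is $i \in \{1,\ldots,N\}$ with $x_i = a_i$, then $f(x_1,\ldots,x_N) = 0$. *)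

(* Defs.v *)
From HB Require Import structures.
From mathcomp Require Export all_boot all_order all_algebra.
From mathcomp.multinomials Require Export mpoly.

Set Implicit Arguments.
Unset Strict Implicit.
Unset Printing Implicit Defensive.

Import GRing.Theory.
Local Open Scope ring_scope.

(* [comNzRingType] excludes the zero ring, over which two distinct elements
   cannot be chosen. The exponent 0 is harmless, as 1 != 0. *)
Definition reduced_ring (K : comNzRingType) : Prop :=
  forall (x : K) (n : nat), x ^+ n = 0 -> x = 0.

Definition num_monomials (N : nat) (K : comNzRingType) (f : {mpoly K[N]}) : nat :=
  size (msupp f).

Definition box (N : nat) (K : Type) (A : 'I_N -> K -> Prop) (x : 'I_N -> K) : Prop :=
  forall i, A i (x i).

Definition absorbing (N : nat) (K : comNzRingType) (f : {mpoly K[N]})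
    (a : 'I_N -> K) (Q : ('I_N -> K) -> Prop) : Prop :=
  forall x : 'I_N -> K, Q x -> (exists i, x i = a i) -> f.@[x] = 0.

(* Main.v *)
Require Import Defs.
From mathcomp Require Import all_boot all_order all_algebra.
From mathcomp.multinomials Require Import mpoly.
Local Open Scope ring_scope.

(** The bound is proved one variable at a time. Let [(a, b, r)] belong to the
    last variable. For each residue [k < r], the combination
    [a ^ k f(y, b) - b ^ k f(y, a)] is a polynomial in the other variables [y]
    in which all monomials of [f] whose last exponent is congruent to [k]
    modulo [r] cancel, because [a ^ r = b ^ r]; it is still absorbing, and
    its value at the remaining [b]'s is [a ^ k f(b)]. Every monomial of [f]
    is cancelled for exactly one [k], so summing the induction hypothesis over
    the [r] residues gives the factor [r / (r - 1)]. Reducedness keeps the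
    values nonzero: if [x b != 0] then [x a ^ k != 0]. *)

Import Order.TTheory GRing.Theory Num.Theory.

(** If [x * a ^+ k = 0], then [x * b ^+ r = x * a ^+ r = 0], so [x * b] is nilpotent. The exponent
    [r.+1] also covers [r = 0]. *)
Lemma reduced_mulX_neq0 (K : comNzRingType) (a b x : K) (r k : nat) :
  reduced_ring K -> a ^+ r = b ^+ r -> (k <= r)%N -> x * b != 0 ->
  x * a ^+ k != 0.
Proof.
move=> redK abr le_kr; apply: contraNneq => xak0.
have xbr0 : x * b ^+ r = 0 by rewrite -abr -(subnKC le_kr) exprD mulrA xak0 mul0r.
apply/eqP/(redK _ r.+1).
by rewrite exprMn !exprSr -mulrA [x * _]mulrA xbr0 mul0r mulr0.
Qed.

(** Full [r]-th powers of [a] and [b] are interchangeable, and what remains of both exponents is the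
    same residue. *)
Lemma cross_expr_eq0 (K : comNzRingType) (a b : K) (r k e : nat) :
  a ^+ r = b ^+ r -> e = k %[mod r] ->
  b ^+ e * a ^+ k - b ^+ k * a ^+ e = 0.
Proof.
move=> abr ek.
have pw q : a ^+ (q * r) = b ^+ (q * r) by rewrite mulnC !exprM abr.
rewrite (divn_eq e r) (divn_eq k r) ek !exprD !pw.
by rewrite mulrACA [X in X * _]mulrC mulrACA subrr.
Qed.

(** Double counting: each [t] is left out for exactly one [k]. *)
Lemma sum_count_neq_modn (T : Type) (s : seq T) (e : T -> nat) (r : nat) :
  (0 < r)%N ->
  (\sum_(k < r) count (fun t => e t %% r != k) s = r.-1 * size s)%N.
Proof.
move=> r_gt0.
under eq_bigr do rewrite -sum1_count big_mkcond.
rewrite exchange_big /= -sum1_size big_distrr /=; apply: eq_bigr => t _.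
have lt_er : (e t %% r < r)%N by rewrite ltn_pmod.
rewrite -big_mkcond sum1_card muln1 -[in RHS](card_ord r).
rewrite -(cardC1 (Ordinal lt_er)); apply: eq_card => k.
by rewrite !inE eq_sym.
Qed.

(* Exponents of variables outside [v] are ignored, so that eliminating a
   variable only changes the coefficients [c] and the list [s] of terms. *)
Lemma absorbing_sum_size (K : comNzRingType) (I : eqType) (T : Type)
    (a b : I -> K) (r : I -> nat) (e : T -> I -> nat) (v : seq I)
    (s : seq T) (c : T -> K) :
  reduced_ring K -> (forall i, 0 < r i)%N ->
  (forall i, a i ^+ r i = b i ^+ r i) -> uniq v ->
  (forall x : I -> K, (forall i, x i = a i \/ x i = b i) ->
     (exists2 i, i \in v & x i = a i) ->
     \sum_(t <- s) c t * \prod_(i <- v) x i ^+ e t i = 0) ->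
  (\prod_(i <- v) b i) * (\sum_(t <- s) c t * \prod_(i <- v) b i ^+ e t i) != 0 ->
  (\prod_(i <- v) r i <= \prod_(i <- v) (r i).-1 * size s)%N.
Proof.
move=> redK r_gt0 abr; elim: v s c => [|j v IHv] s c /=.
  move=> _ _; rewrite !big_nil mul1r mul1n => nz; case: s nz => //.
  by rewrite big_nil eqxx.
case/andP=> vj uv absf nzf.
pose upd (x : I -> K) y i := if i == j then y else x i.
have updE (x : I -> K) y t :
    \prod_(i <- j :: v) upd x y i ^+ e t i =
    y ^+ e t j * \prod_(i <- v) x i ^+ e t i.
  rewrite big_cons /upd eqxx; congr (_ * _); apply: eq_big_seq => i iv.
  by case: eqP vj => // <-; rewrite iv.
have upd_ab (x : I -> K) y : (forall i, x i = a i \/ x i = b i) ->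
    y = a j \/ y = b j -> forall i, upd x y i = a i \/ upd x y i = b i.
  by move=> xab yab i; rewrite /upd; case: eqP => [->|_].
pose cross k t := c t * (b j ^+ e t j * a j ^+ k - b j ^+ k * a j ^+ e t j).
pose keep k t := (e t j %% r j != k)%N.
have sumE k (x : I -> K) : (k < r j)%N ->
    \sum_(t <- [seq t <- s | keep k t]) cross k t * \prod_(i <- v) x i ^+ e t i
    = a j ^+ k *
        (\sum_(t <- s) c t * \prod_(i <- j :: v) upd x (b j) i ^+ e t i)
      - b j ^+ k *
        (\sum_(t <- s) c t * \prod_(i <- j :: v) upd x (a j) i ^+ e t i).
  move=> lt_kr; rewrite big_filter !mulr_sumr -sumrB big_mkcond /=.
  apply: eq_bigr => t _; rewrite !updE /keep.
  (* The filter may be ignored: every term it drops has [cross k t = 0]. *)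
  transitivity (cross k t * \prod_(i <- v) x i ^+ e t i); last first.
    rewrite /cross mulrBr mulrBl; congr (_ - _).
      by rewrite !mulrA [c t * _ * _]mulrC !mulrA.
    by rewrite !mulrA [c t * _]mulrC.
  case: eqP => //= ek.
  by rewrite /cross (@cross_expr_eq0 _ _ _ (r j)) ?mulr0 ?mul0r // ek modn_small.
have step k : (k < r j)%N ->
    (\prod_(i <- v) r i <= \prod_(i <- v) (r i).-1 * count (keep k) s)%N.
  move=> lt_kr; rewrite -size_filter; apply: (IHv _ (cross k)) => //.
    move=> x xab [i iv xi]; rewrite sumE //.
    (* Since [i] differs from [j], it still absorbs whichever value is put at [j], so both sums
       vanish. *)
    have ij : (i == j) = false by apply: contraNF vj => /eqP <-.
    have xv y : exists2 i0, i0 \in j :: v & upd x y i0 = a i0.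
      by exists i; rewrite ?inE ?iv ?orbT // /upd ij.
    rewrite !absf ?mulr0 ?subr0 //; apply: upd_ab => //; [by left | by right].
  have updb i : upd b (b j) i = b i by rewrite /upd; case: eqP => [->|].
  (* Here the second sum vanishes because coordinate [j] takes the value [a j]. *)
  rewrite sumE // [X in _ - _ * X]absf; first last.
  - by exists j; rewrite ?inE ?eqxx // /upd eqxx.
  - by apply: upd_ab; [right | left].
  rewrite mulr0 subr0 mulrCA mulrC.
  apply: (@reduced_mulX_neq0 _ _ (b j) _ (r j)); rewrite ?(ltnW lt_kr) //.
  move: nzf; rewrite big_cons; congr (_ != 0).
  rewrite [RHS]mulrC mulrA; congr (_ * _); apply: eq_bigr => t _.
  by congr (_ * _); apply: eq_bigr => i _; rewrite updb.
rewrite !big_cons mulnC.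
(* The factor [r j] becomes a sum over residues, to be compared with [step] term by term. *)
have -> : (\prod_(i <- v) r i * r j = \sum_(k < r j) \prod_(i <- v) r i)%N.
  by rewrite sum_nat_const card_ord mulnC.
rewrite -mulnA mulnCA -(@sum_count_neq_modn _ _ (e ^~ j)) // big_distrr /=.
by apply: leq_sum => k _; apply: step.
Qed.

Theorem theorem2p2 (N : nat) (hN : (0 < N)%N)
    (K : comNzRingType) (hK : reduced_ring K)
    (f : {mpoly K[N]}) (a b : 'I_N -> K)
    (ha : forall i, a i != 0) (hb : forall i, b i != 0)
    (hab : forall i, a i != b i)
    (r : 'I_N -> nat) (hr : forall i, (0 < r i)%N)
    (hpow : forall i, a i ^+ r i = b i ^+ r i)
    (habs : absorbing f a (box (fun i y => y = a i \/ y = b i)))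
    (hfb : (\prod_(i < N) b i) * f.@[b] != 0) :
  \prod_(i < N) ((r i)%:R / ((r i)%:R - 1)) <= (num_monomials f)%:R :> rat.
Proof.
(* An exponent 1 would force [a i = b i]; hence the denominators are positive. *)
have r_gt1 i : (1 < r i)%N.
  case: (r i) (hr i) (hpow i) => [|[|n]] // _.
  by rewrite !expr1 => abi; move: (hab i); rewrite abi eqxx.
have bound : (\prod_i r i <= \prod_i (r i).-1 * num_monomials f)%N.
  apply: (@absorbing_sum_size K _ 'X_{1..N} a b r (fun m i => m i)
    (index_enum 'I_N) (msupp f) (fun m => f@_m)) => //.
  - exact: index_enum_uniq.
  - by move=> x xab [i _ xi]; have := habs x xab; rewrite mevalE; apply; exists i.
have -> : \prod_(i < N) ((r i)%:R / ((r i)%:R - 1)) =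
          (\prod_i r i)%:R / (\prod_i (r i).-1)%:R :> rat.
  rewrite !natr_prod -prodf_div; apply: eq_bigr => i _.
  by rewrite -subn1 natrB.
rewrite ler_pdivrMr -?natrM ?ler_nat 1?mulnC // ltr0n.
by apply: prodn_gt0 => i; rewrite -ltnS prednK.
Qed.
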